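(* Let $\mathbb{K}$ be a field of characteristic $0$. For a positive integer $r$, let $\mu(r)$ be the least integer $h$ such that $(1,r,h,h,r,1)$ is the Hilbert function of a standard graded Artinian Gorenstein $\mathbb{K}$-algebra (socle degree $5$), and let $\delta(r)=r-\mu(r)$. Then for every $m\in\{3,4,5,6,7,8,9,10\}$, \[\delta\!\left(m+\binom{m+3}{4}\right)=\frac{m+5}{4}\binom{m}{3}.\]
   Context: Standard graded Artinian Gorenstein algebras $Q/I$ are taken with $I$ containing no linear forms, so the codimension equals $h_1$. *)

(* Defs.v *)
From HB Require Import structures.
From mathcomp Require Import all_boot all_order all_algebra.
From mathcomp.multinomials Require Import mpoly.
Set Implicit Arguments. Unset Strict Implicit. Unset Printing Implicit Defensive.
Import GRing.Theory.
Local Open Scope ring_scope.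

(* p is homogeneous of degree d (0 counts as homogeneous of every degree) *)
Definition is_homog (K : fieldType) (n d : nat) (p : {mpoly K[n]}) : Prop :=
  forall m, m \in msupp p -> mdeg m = d.

Definition hcomp (K : fieldType) (n d : nat) (p : {mpoly K[n]}) : {mpoly K[n]} :=
  \sum_(m <- msupp p | mdeg m == d) p@_m *: 'X_[m].

Definition is_ideal (K : fieldType) (n : nat) (I : {mpoly K[n]} -> Prop) : Prop :=
  [/\ I 0,
      (forall p q, I p -> I q -> I (p + q)) &
      (forall p q, I q -> I (p * q))].

Definition is_homog_ideal (K : fieldType) (n : nat) (I : {mpoly K[n]} -> Prop) : Prop :=
  is_ideal I /\ forall p d, I p -> I (hcomp d p).

Definition no_linear_forms (K : fieldType) (n : nat) (I : {mpoly K[n]} -> Prop) : Prop :=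
  forall p, is_homog 1 p -> I p -> p = 0.

Definition artinian_quot (K : fieldType) (n : nat) (I : {mpoly K[n]} -> Prop) : Prop :=
  exists N : nat, forall d p, (N <= d)%N -> is_homog d p -> I p.

Definition in_socle (K : fieldType) (n : nat) (I : {mpoly K[n]} -> Prop)
    (s : {mpoly K[n]}) : Prop :=
  forall i : 'I_n, I (s * 'X_i).

Definition gorenstein_quot (K : fieldType) (n : nat) (I : {mpoly K[n]} -> Prop) : Prop :=
  exists s, [/\ in_socle I s, ~ I s &
    forall t, in_socle I t -> exists c : K, I (t - c *: s)].

Definition hilb_fun_at (K : fieldType) (n : nat) (I : {mpoly K[n]} -> Prop)
    (d h : nat) : Prop :=
  exists b : 'I_h -> {mpoly K[n]},
    [/\ forall j, is_homog d (b j),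
        (forall c : 'I_h -> K, I (\sum_j c j *: b j) -> forall j, c j = 0) &
        (forall p, is_homog d p -> exists c : 'I_h -> K, I (p - \sum_j c j *: b j))].

(* Q/I is a standard graded Artinian Gorenstein K-algebra of codimension n
   (I homogeneous, containing no linear forms) with Hilbert function hs,
   i.e. H(Q/I, d) = nth 0 hs d for all d (zero beyond the listed values). *)
Definition SGAG_with_hilb (K : fieldType) (n : nat) (I : {mpoly K[n]} -> Prop)
    (hs : seq nat) : Prop :=
  [/\ is_homog_ideal I, no_linear_forms I, artinian_quot I, gorenstein_quot I &
      forall d, hilb_fun_at I d (nth 0%N hs d)].

Definition realizable (K : fieldType) (r h : nat) : Prop :=
  exists I : {mpoly K[r]} -> Prop, SGAG_with_hilb I [:: 1%N; r; h; h; r; 1%N].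

Definition is_mu (K : fieldType) (r h : nat) : Prop :=
  realizable K r h /\ forall h', realizable K r h' -> (h <= h')%N.

(* Main.v *)
From HB Require Import structures.
Require Import Defs.
From mathcomp Require Import all_boot all_order all_algebra.
From mathcomp.multinomials Require Import mpoly.
From Stdlib Require Import Classical ClassicalEpsilon.
From mathcomp Require Import zify.
Set Implicit Arguments. Unset Strict Implicit. Unset Printing Implicit Defensive.
Import GRing.Theory.
Local Open Scope ring_scope.

(* The minimum is mu = C(m+2,3) + C(m+1,2).

   It is attained by the trivial extension of K[x_1..x_m]/(x)^5, that is, by the
   inverse system of the quintic sum_M y_M M over the quartic monomials M in x,
   under the contraction action.

   For the lower bound, let x, y, z be generic linear forms, let a, c, k be the
   ranks of x, xy, xyz on A_1, and put p1 = r - a, p2 = a - c, p3 = c - k.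
   Multiplication by y sends ker x in A_1 into ker x in y A_1, of dimension p2, and
   z sends the latter into ker x in yz A_1, of dimension p3.  The dual form of
   Green's hyperplane restriction theorem bounds the kernels of these two maps.
   The form (u, v) |-> xyz u v on A_1 is symmetric of rank k, maximal when z
   varies, so its kernel is isotropic for every xyt u v; by Green again this
   forces k to be large compared with p3.  As dim A_2 >= p2 + p3 + c, and
   r = p1 + p2 + p3 + k, the bound follows by arithmetic. *)

(** * Generic rank and Green's theorem *)

Lemma exists_max_nat (T : Type) (x0 : T) (f : T -> nat) (B : nat) :
  (forall x, f x <= B)%N -> exists x, forall y, (f y <= f x)%N.
Proof.
move=> fB; have [n] : exists n, (B - f x0 < n)%N by exists (B - f x0).+1.
elim: n x0 => // n IHn x lt_n.
case: (classic (exists y, (f x < f y)%N)) => [[y lt_xy]|max_x].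
  by apply: (IHn y); have := fB y; lia.
exists x => y; rewrite leqNgt; apply/negP => lt_xy.
by apply: max_x; exists y.
Qed.

Lemma submx_of_rank (K : fieldType) m n (A : 'M[K]_(m, n)) k :
  (k <= \rank A)%N -> exists B : 'M[K]_n, (B <= A)%MS /\ \rank B = k.
Proof.
move=> le_k; exists (<<pid_mx k *m row_base A : 'M_(\rank A, n)>>)%MS.
rewrite mxrank_gen genmxE (submx_trans (submxMl _ _)) ?eq_row_base //.
by rewrite mxrankMfree ?row_base_free // rank_pid_mx.
Qed.

Section Infinite.

Variable K : fieldType.
Hypothesis charK0 : [pchar K] =i pred0.

(** Characteristic 0 makes the images of [0, ..., size p - 1] distinct, one more than [p] can have
    roots. *)
Lemma exists_nonroot (p : {poly K}) : p != 0 -> exists t, p.[t] != 0.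
Proof.
move=> p_neq0; pose s := [seq i%:R : K | i <- iota 0 (size p)].
have s_uniq : uniq s.
  rewrite map_inj_uniq ?iota_uniq // => i j.
  wlog le_ij : i j / (i <= j)%N => [W|/eqP].
    by case/orP: (leq_total i j) => /W // Wij /esym /Wij.
  have /pcharf0P natK0 := charK0.
  rewrite eq_sym -subr_eq0 -natrB // natK0 subn_eq0 => le_ji.
  by apply/eqP; rewrite eqn_leq le_ij.
case: (boolP (all (root p) s)) => [/(max_poly_roots p_neq0)/(_ s_uniq)|].
  by rewrite size_map size_iota ltnn.
by case/allPn => t _ pt; exists t.
Qed.

(* A substitute for "contains a dense Zariski open set": it suffices to control
   lines through points of [P]. *)
Definition generic (V : lmodType K) (P : V -> Prop) :=
  (exists u, P u) /\
  forall u v, P u ->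
    exists p : {poly K}, p != 0 /\ forall t, p.[t] != 0 -> P (u + t *: v).

(** On the line joining a point of [P] to a point of [Q], each property can fail only at roots of a
    nonzero polynomial. The second one is parametrised from the other end, hence the substitution of
    [1 - 'X]. *)
Lemma generic_and (V : lmodType K) (P Q : V -> Prop) :
  generic P -> generic Q -> generic (fun u => P u /\ Q u).
Proof.
move=> [[u Pu] gP] [[v Qv] gQ]; split.
  have [p [p_neq0 pP]] := gP u (v - u) Pu.
  have [q [q_neq0 qQ]] := gQ v (u - v) Qv.
  have [t] : exists t, (p * (q \Po (1 - 'X))).[t] != 0.
    apply: exists_nonroot; rewrite mulf_neq0 //.
    apply: contra q_neq0 => /eqP q0; rewrite -[q]comp_polyXr.
    have -> : 'X = (1 - 'X : {poly K}) \Po (1 - 'X).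
      by rewrite comp_polyB comp_polyX comp_polyC opprB addrCA subrr addr0.
    by rewrite comp_polyA q0 comp_poly0.
  rewrite hornerM mulf_eq0 negb_or horner_comp !hornerE => /andP[/pP Pt /qQ Qt].
  exists (u + t *: (v - u)); split=> //.
  suff -> : u + t *: (v - u) = v + (1 - t) *: (u - v) by [].
  rewrite scalerBl scale1r -[u - v]opprB scalerN opprK addrA; congr (_ + _).
  by rewrite opprB addrC subrK.
move=> {Pu Qv} x y [Px Qx]; have [p [p_neq0 pP]] := gP x y Px.
have [q [q_neq0 qQ]] := gQ x y Qx; exists (p * q).
rewrite mulf_neq0 //; split=> // t.
by rewrite hornerM mulf_eq0 negb_or => /andP[/pP ? /qQ].
Qed.

(** Compress [A] to an identity block [U *m A *m V]. The determinant of the compressed pencil is a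
    polynomial in [t] with value 1 at 0; where it is nonzero the rank has not dropped. *)
Lemma rank_pencil m n (A B : 'M[K]_(m, n)) :
  exists p : {poly K}, p != 0 /\
    forall t, p.[t] != 0 -> (\rank A <= \rank (A + t *: B)%R)%N.
Proof.
have [U [V UAV]] : exists U : 'M_(\rank A, m), exists V, U *m A *m V = 1%:M.
  have /row_fullP[U U1] := col_base_full A.
  have /row_freeP[V V1] := row_base_free A.
  have UA : U *m A = row_base A.
    by rewrite -[RHS]mul1mx -U1 -mulmxA mulmx_base.
  by exists U, V; rewrite UA V1.
pose M := map_mx polyC (U *m A *m V) + 'X *: map_mx polyC (U *m B *m V).
have evalM t : (\det M).[t] = \det (U *m (A + t *: B) *m V).
  rewrite -horner_evalE -det_map_mx; congr (\det _).
  rewrite mulmxDr mulmxDl -scalemxAr -scalemxAl; apply/matrixP => i j.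
  by rewrite !mxE /= horner_evalE !hornerE.
exists (\det M); split=> [|t].
  apply/eqP => M0; have := evalM 0.
  by rewrite M0 horner0 scale0r addr0 UAV det1 => /eqP; rewrite eq_sym oner_eq0.
rewrite evalM -unitfE => detU.
have rUV : \rank (U *m (A + t *: B) *m V) = \rank A.
  by apply: mxrank_unit; rewrite unitmxE.
apply: leq_trans (eq_leq (esym rUV)) _.
apply: leq_trans (mxrankM_maxl _ _) _. exact: mxrankM_maxr.
Qed.

Lemma generic_rank (V : lmodType K) m n (T : V -> 'M[K]_(m, n)) k :
  linear T -> (exists u, k <= \rank (T u))%N ->
  generic (fun u => k <= \rank (T u))%N.
Proof.
move=> linT ex_u; split=> // u v le_k.
have [p [p_neq0 pP]] := rank_pencil (T u) (T v).
exists p; split=> // t /pP; rewrite [u + _]addrC linT [_ + T u]addrC; exact: leq_trans.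
Qed.

(* If [x] is in the kernel of [S] but [x T] is not orthogonal to it, then
   replacing [x (S + t T)] by [x T] gives a family of matrices whose rank at
   [t = 0] already exceeds that of [S]. *)
Lemma sym_pencil_isotropic n (S T : 'M[K]_n) :
  S^T = S -> (forall t, \rank (S + t *: T)%R <= \rank S)%N ->
  kermx S *m T *m (kermx S)^T = 0.
Proof.
move=> symS maxS; apply/matrixP => i j; rewrite [RHS]mxE.
set x := row i (kermx S); set y := row j (kermx S).
have xS : x *m S = 0 by apply/sub_kermxP/row_sub.
have yS : y *m S = 0 by apply/sub_kermxP/row_sub.
have -> : (kermx S *m T *m (kermx S)^T) i j = (x *m T *m y^T) 0 0.
  rewrite -row_mul [RHS]mxE [LHS]mxE; apply: eq_bigr => l _.
  by rewrite !mxE.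
apply/eqP/contraT => xTy.
(* The rows of [S] are orthogonal to [y] because [S] is symmetric, while [x *m T] is not. *)
have xT_S : ~~ (x *m T <= S)%MS.
  apply: contra xTy => /submxP[z ->].
  by rewrite -mulmxA -[S]symS -trmx_mul yS trmx0 mulmx0 mxE.
have lt_rank : (\rank S < \rank (col_mx S (x *m T)))%N.
  rewrite -addsmxE rank_ltmx // ltmxE addsmxSl /=.
  by apply: contra xT_S; apply/submx_trans/addsmxSr.
have [p [p_neq0 pP]] := rank_pencil (col_mx S (x *m T)) (col_mx T 0).
have [t] : exists t, (p * 'X).[t] != 0.
  by apply: exists_nonroot; rewrite mulf_neq0 ?polyX_eq0.
rewrite hornerMX mulf_eq0 negb_or => /andP[/pP le_p t_neq0].
have := leq_trans lt_rank le_p; rewrite ltnNge => /negP[].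
apply: leq_trans (maxS t); apply: mxrankS.
rewrite scale_col_mx scaler0 add_col_mx addr0 col_mx_sub submx_refl.
apply/submxP; exists (t^-1 *: x).
by rewrite -scalemxAl mulmxDr xS add0r -scalemxAr scalerA mulVf // scale1r.
Qed.

(** Frobenius' inequality for [kermx S], [T] and [(kermx S)^T], whose product vanishes, bounds the
    doubled rank by that of [T]. *)
Lemma rank_ker_sym_pencil n (S T : 'M[K]_n) :
  S^T = S -> T^T = T -> (forall t, \rank (S + t *: T)%R <= \rank S)%N ->
  (\rank T <= \rank S)%N -> ((\rank (kermx S *m T)).*2 <= \rank S)%N.
Proof.
move=> symS symT maxS; apply: leq_trans.
have := mxrank_Frobenius (kermx S) T (kermx S)^T.
rewrite sym_pencil_isotropic // mxrank0 addn0 -addnn.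
by rewrite -[\rank (T *m _)]mxrank_tr trmx_mul trmxK symT.
Qed.

(** * The dual form of Green's theorem *)

Section Green.

Variables (V : lmodType K) (N : nat) (L : V -> 'M[K]_N) (F : nat -> 'M[K]_N).
Hypothesis linL : linear L.
Hypothesis commL : forall u v, L u *m L v = L v *m L u.
Hypothesis FL : forall n u, (F n.+1 *m L u <= F n)%MS.
Hypothesis F_nondeg : forall n (v : 'rV[K]_N),
  (v <= F n.+1)%MS -> (forall u, v *m L u = 0) -> v = 0.

Lemma linear_mulL m (A : 'M[K]_(m, N)) : linear (fun u => A *m L u).
Proof. by move=> t u v; rewrite linL mulmxDr -scalemxAr. Qed.

Lemma exists_mulL_neq0 n (W : 'M[K]_N) :
  (W <= F n.+1)%MS -> W != 0 -> exists u, W *m L u != 0.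
Proof.
move=> WF /rowV0Pn[v vW v_neq0]; apply: NNPP => W0; case/eqP: v_neq0.
apply: (F_nondeg (submx_trans vW WF)) => u.
apply/eqP/contraT => vu; case: W0; exists u.
case/submxP: vW vu => D ->; rewrite -mulmxA; apply: contra => /eqP ->.
by rewrite mulmx0.
Qed.

(* Two generic elements [g], [h]: the kernel of [h] on [W] is cut by [g] into
   its image, inside the kernel of [h] on [W g], and the kernel of [h] on the
   kernel of [g]. *)
Lemma green_ker n a (W : 'M[K]_N) :
  (W <= F n.+1)%MS -> (\rank W <= 'C(a, n.+1) + n)%N ->
  exists u, (\rank (W :&: kermx (L u)) <= 'C(a.-1, n.+1))%N.
Proof.
elim: n a W => [|n IHn] a W.
  rewrite bin1 addn0 => WF le_a; have [W0|/(exists_mulL_neq0 WF)[u]] := eqVneq W 0.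
    by exists 0; rewrite W0 cap0mx mxrank0.
  rewrite -mxrank_eq0 => Wu; exists u; rewrite bin1.
  by have := mxrank_mul_ker W (L u); lia.
have [k] := ubnP (\rank W); elim: k => // k IHk in a W * => lt_k WF le_a.
apply: NNPP => noW; set c := 'C(a.-1, n.+2) in noW.
have ker_gt u : (c < \rank (W :&: kermx (L u)))%N.
  by rewrite ltnNge; apply/negP => le_c; apply: noW; exists u.
have W_gt0 : (0 < \rank W)%N.
  by have := ker_gt 0; have := mxrankS (capmxSl W (kermx (L 0))); lia.
have W_neq0 : W != 0 by rewrite -mxrank_eq0 -lt0n.
(* On a hyperplane [W'] of [W] the inner induction finds [g] with kernel of rank at most [c]; since
   every kernel on [W] exceeds [c], that of [g] has rank exactly [c.+1]. *)
have [W' [W'W rW']] := submx_of_rank (leq_pred (\rank W)).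
have [g ker_g'] : exists u, (\rank (W' :&: kermx (L u)) <= c)%N.
  by apply: IHk; [lia | exact: submx_trans WF | lia].
have ker_g : \rank (W :&: kermx (L g)) = c.+1.
  apply/eqP; rewrite eqn_leq ker_gt andbT.
  have := mxrank_mul_ker W (L g); have := mxrank_mul_ker W' (L g).
  by have := mxrankS (submxMr (L g) W'W); lia.
have lt_c : (c.+1 < \rank W)%N.
  have [u] := exists_mulL_neq0 WF W_neq0; rewrite -mxrank_eq0 => Wu.
  by have := mxrank_mul_ker W (L u); have := ker_gt u; lia.
have binE : ('C(a, n.+2) <= 'C(a.-1, n.+1) + c)%N.
  by rewrite /c; case: (a) => // b; rewrite binS addnC.
have rWg := mxrank_mul_ker W (L g); rewrite ker_g in rWg.
(* Passing to [W *m L g] loses [c.+1] dimensions: Pascal's rule accounts for [c], and the last one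
   lowers the additive slack from [n.+1] to [n]. On the kernel of [g] the slack absorbs the excess
   of 1 over [c]. *)
have [h1 ker_h1] : exists u,
    (\rank (W *m L g :&: kermx (L u)) <= 'C(a.-1.-1, n.+1))%N.
  by apply: IHn; [exact: submx_trans (submxMr _ WF) (FL _ _) | lia].
have [h2 ker_h2] : exists u,
    (\rank ((W :&: kermx (L g)) :&: kermx (L u)) <= 'C(a.-1.-1, n.+2))%N.
  by apply: IHk; rewrite ?ker_g /c; [lia | exact: submx_trans (capmxSl _ _) WF | lia].
have [] := generic_and
  (generic_rank (linear_mulL (W *m L g)) (ex_intro _ h1 (leqnn _)))
  (generic_rank (linear_mulL (W :&: kermx (L g))%MS) (ex_intro _ h2 (leqnn _))).
move=> [h [rh1 rh2]] _.
have := mxrank_mul_ker (W *m L g) (L h); have := mxrank_mul_ker (W *m L g) (L h1).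
have := mxrank_mul_ker (W :&: kermx (L g))%MS (L h).
have := mxrank_mul_ker (W :&: kermx (L g))%MS (L h2).
have := mxrank_mul_ker (W :&: kermx (L h))%MS (L g).
have : (\rank ((W :&: kermx (L h))%MS *m L g) <=
        \rank ((W *m L g) :&: kermx (L h)))%N.
  apply: mxrankS; rewrite sub_capmx submxMr ?capmxSl //=.
  by apply/sub_kermxP; rewrite -mulmxA commL mulmxA (sub_kermxP (capmxSr _ _)) mul0mx.
rewrite -capmxA [(kermx (L h) :&: _)%MS]capmxC capmxA => le1.
have binE' : ('C(a.-1.-1, n.+1) + 'C(a.-1.-1, n.+2) <= c)%N.
  by rewrite /c; case: (a.-1) => // b; rewrite binS addnC.
by have := ker_gt h; lia.
Qed.

(** The bound on kernels is applied to a subspace of [W] cut down to the largest admissible rank. *)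
Lemma green_rank n a (W : 'M[K]_N) : (W <= F n.+1)%MS ->
  exists u, (minn (\rank W) ('C(a, n.+1) + n) <=
             \rank (W *m L u) + 'C(a.-1, n.+1))%N.
Proof.
move=> WF; have [W' [W'W rW']] := submx_of_rank (geq_minl (\rank W) ('C(a, n.+1) + n)).
have [|u ker_u] := green_ker (a := a) (submx_trans W'W WF).
  by rewrite rW' geq_minr.
exists u; rewrite -rW' -(mxrank_mul_ker W' (L u)) leq_add //.
by rewrite mxrankS // submxMr.
Qed.

End Green.
End Infinite.

(** * Lower bound for a graded algebra with a symmetric pairing *)

Section LowerBound.

Variables (K : fieldType) (V : lmodType K) (N : nat).
Variables (L : V -> 'M[K]_N) (E : nat -> 'M[K]_N) (B : 'M[K]_N).
Hypothesis charK0 : [pchar K] =i pred0.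
Hypothesis linL : linear L.
Hypothesis commL : forall u v, L u *m L v = L v *m L u.
Hypothesis EL : forall d u, (E d *m L u <= E d.+1)%MS.
Hypothesis E_nondeg : forall d (v : 'rV[K]_N), (d < 5)%N ->
  (v <= E d)%MS -> (forall u, v *m L u = 0) -> v = 0.
Hypothesis symB : B^T = B.
Hypothesis adjB : forall u, B *m (L u)^T = L u *m B.
Hypothesis B_nondeg : forall d (v : 'rV[K]_N), (d <= 5)%N ->
  (v <= E d)%MS -> v *m (B *m (E (5 - d)%N)^T) = 0 -> v = 0.

(** [B *m (E (5 - d))^T] represents the map from degree [d] to the dual of degree [5 - d], which
    nondegeneracy makes injective. *)
Lemma rank_pairing d m (A : 'M_(m, N)) : (d <= 5)%N -> (A <= E d)%MS ->
  \rank (A *m (B *m (E (5 - d)%N)^T)) = \rank A.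
Proof.
move=> le_d AE; apply/mxrank_injP/rowV0P => v.
rewrite sub_capmx => /andP[vA /sub_kermxP].
exact/B_nondeg/(submx_trans vA).
Qed.

(** Degrees are counted down from the socle, as Green's theorem expects. From 5 on the value is 0,
    because the truncated [5 - n] would stay stuck at degree 0. *)
Let F n := if (n < 5)%N then E (5 - n)%N else 0.

Let FL n u : (F n.+1 *m L u <= F n)%MS.
Proof.
rewrite /F; case: ltnP => [lt_n|_]; last by rewrite mul0mx sub0mx.
by rewrite ltnW // (_ : (5 - n = (5 - n.+1).+1)%N) ?EL //; lia.
Qed.

Let F_nondeg n (v : 'rV[K]_N) :
  (v <= F n.+1)%MS -> (forall u, v *m L u = 0) -> v = 0.
Proof.
rewrite /F; case: ltnP => [lt_n|_ /[!submx0] /eqP //].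
by apply: E_nondeg; lia.
Qed.

(** Multiplication by the product of the two forms, from degree 1 to 3 and from degree 2 to 4, gives
    adjoint maps under the pairing. *)
Let dual_rank u v : \rank (E 1 *m L u *m L v) = \rank (E 2 *m L u *m L v).
Proof.
have sub d : (E d *m L u *m L v <= E d.+2)%MS.
  exact: submx_trans (submxMr _ (EL _ _)) (EL _ _).
rewrite -(rank_pairing _ (sub 1%N)) // -(rank_pairing _ (sub 2%N)) // -mxrank_tr.
rewrite !trmx_mul trmxK symB -!mulmxA; congr (\rank (_ *m _)).
by rewrite ![B *m (_ *m _)]mulmxA !adjB -!mulmxA [B *m (_ *m _)]mulmxA adjB !mulmxA -commL.
Qed.

Lemma pairing_rank_bound m : (0 < m)%N ->
  \rank (E 1) = (m + 'C(m + 3, 4))%N ->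
  ('C(m + 2, 3) + 'C(m + 1, 2) <= \rank (E 2))%N.
Proof.
move=> m_gt0 rE1.
have linA m' (A : 'M_(m', N)) : linear (fun u => A *m L u) by exact: linear_mulL.
have linAM m' (A : 'M_(m', N)) n' (M : 'M_(N, n')) : linear (fun u => A *m L u *m M).
  by move=> t u v; rewrite linA mulmxDl -scalemxAl.
have max1 : exists u, forall v, (\rank (E 1 *m L v) <= \rank (E 1 *m L u))%N.
  apply: (exists_max_nat 0 (f := fun u => \rank (E 1 *m L u)) (B := N)) => u.
  exact: rank_leq_row.
have max2 : exists u v, forall u' v',
    (\rank (E 1 *m L u' *m L v') <= \rank (E 1 *m L u *m L v))%N.
  have [|[u v] uvP] := @exists_max_nat (V * V)%type 0
    (fun u => \rank (E 1 *m L u.1 *m L u.2)) N; first by move=> u; exact: rank_leq_row.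
  by exists u, v => u' v'; apply: (uvP (u', v')).
have max3 : exists u v w, forall u' v' w',
    (\rank (E 1 *m L u' *m L v' *m L w') <= \rank (E 1 *m L u *m L v *m L w))%N.
  have [|[[u v] w] uvwP] := @exists_max_nat (V * V * V)%type 0
    (fun u => \rank (E 1 *m L u.1.1 *m L u.1.2 *m L u.2)) N.
    by move=> u; exact: rank_leq_row.
  by exists u, v, w => u' v' w'; apply: (uvwP (u', v', w')).
have {max1} [u1] := max1; set a := \rank _ => max1.
have {max2} [u2 [v2]] := max2; set c := \rank _ => max2.
have {max3} [u3 [v3 [w3]]] := max3; set k := \rank _ => max3.
(* The forms [x], [y], [z] are chosen one after another. Each keeps the maximal ranks [a], [c], [k]
   within reach of the forms still to come; [y] and [z] must also satisfy Green's bound. *)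
have [[x [[ax cx] kx]] _] := generic_and charK0 (generic_and charK0
  (generic_rank (linA _ (E 1)) (ex_intro _ u1 (leqnn _)))
  (generic_rank (linAM _ (E 1) _ (L v2)) (ex_intro _ u2 (leqnn _))))
  (generic_rank (linAM _ (E 1) _ (L v3 *m L w3))
    (ex_intro _ u3 (eq_leq (congr1 _ (mulmxA _ _ _))))).
have {}kx : (k <= \rank (E 1 *m L x *m L v3 *m L w3))%N.
  by apply: leq_trans (eq_leq _) (leq_trans kx (eq_leq _)); rewrite /k -!mulmxA.
have Ex d m' (A : 'M_(m', N)) u : (A <= E d)%MS -> (A *m L u <= E d.+1)%MS.
  by move=> AE; apply: submx_trans (submxMr _ AE) (EL _ _).
have green n b (W : 'M_N) : (W <= F n.+1)%MS -> exists u,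
    (minn (\rank W) ('C(b, n.+1) + n) <= \rank (W *m L u) + 'C(b.-1, n.+1))%N.
  exact: (@green_rank _ charK0 _ _ _ _ linL commL FL F_nondeg).
pose K1 := (E 1 :&: kermx (L x))%MS.
(* The parameters [m + 2], [m + 1], [m] of the three uses of Green's bound are fitted to the kernel
   ranks ['C(m + 2, 4)], ['C(m + 1, 3)], ['C(m, 2)] of the trivial extension. *)
have [y0 gy0] := @green 3%N (m + 2)%N K1 (capmxSl _ _).
have [[y [[[ay cy] ky] gy]] _] :=
  generic_and charK0 (generic_and charK0 (generic_and charK0
    (generic_rank (linA _ (E 1)) (ex_intro _ u1 (leqnn _)))
    (generic_rank (linA _ (E 1 *m L x)) (ex_intro _ v2 cx)))
    (generic_rank (linAM _ (E 1 *m L x) _ (L w3))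
      (ex_intro _ v3 kx)))
    (generic_rank (linA _ K1) (ex_intro _ y0 (leqnn _))).
have cyx : (c <= \rank (E 1 *m L y *m L x))%N by rewrite -mulmxA commL mulmxA.
have Ey := Ex 1%N _ _ y (submx_refl _); have Ex1 := Ex 1%N _ _ x (submx_refl _).
pose P2 := (E 1 *m L y :&: kermx (L x))%MS.
have [z0 gz0] := @green 2%N (m + 1)%N P2 (submx_trans (capmxSl _ _) Ey).
have [[z [[cz kz] gz]] _] :=
  generic_and charK0 (generic_and charK0
    (generic_rank (linA _ (E 1 *m L y)) (ex_intro _ x cyx))
    (generic_rank (linA _ (E 1 *m L x *m L y)) (ex_intro _ w3 ky)))
    (generic_rank (linA _ P2) (ex_intro _ z0 (leqnn _))).
have Exy := Ex 2%N _ _ y Ex1.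
pose P3 := (E 1 *m L x *m L y :&: kermx (L z))%MS.
have [t gt] := @green 1%N m P3 (submx_trans (capmxSl _ _) Exy).
have rx : \rank (E 1 *m L x) = a by apply/eqP; rewrite eqn_leq max1 ax.
have ry : \rank (E 1 *m L y) = a by apply/eqP; rewrite eqn_leq max1 ay.
have rxy : \rank (E 1 *m L x *m L y) = c by apply/eqP; rewrite eqn_leq max2 cy.
have ryx : \rank (E 1 *m L y *m L x) = c by apply/eqP; rewrite eqn_leq max2 cyx.
have ryz : \rank (E 1 *m L y *m L z) = c by apply/eqP; rewrite eqn_leq max2 cz.
have rxyz : \rank (E 1 *m L x *m L y *m L z) = k.
  by apply/eqP; rewrite eqn_leq max3 kz.
have ker_step m' (A : 'M_(m', N)) u v :
    (((A :&: kermx (L u))%MS *m L v) <= (A *m L v :&: kermx (L u)))%MS.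
  rewrite sub_capmx submxMr ?capmxSl //=; apply/sub_kermxP.
  by rewrite -mulmxA commL mulmxA (sub_kermxP (capmxSr _ _)) mul0mx.
have le12 := mxrankS (ker_step _ (E 1) x y).
have le23 := mxrankS (ker_step _ (E 1 *m L y) x z).
have rK1 := mxrank_mul_ker (E 1) (L x).
have rP2 := mxrank_mul_ker (E 1 *m L y) (L x).
have rP2' := mxrank_mul_ker (E 1 *m L x) (L y).
have rP3 := mxrank_mul_ker (E 1 *m L x *m L y) (L z).
have rP3' := mxrank_mul_ker (E 1 *m L y *m L z) (L x).
have ryzx : \rank (E 1 *m L y *m L z *m L x) = k.
  by rewrite -rxyz -!mulmxA [L z *m _]commL [L y *m (_ *m _)]mulmxA [L y *m _]commL -!mulmxA.
(* Degree 2 is filtered by [y], then [z]. The two kernels have ranks at least p2 and p3, and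
   [dual_rank] gives what remains the rank [c]. *)
have rE2 := mxrank_mul_ker (E 2) (L y).
have rE2' := mxrank_mul_ker (E 2 *m L y) (L z).
have leE2 : (\rank (E 1 *m L x :&: kermx (L y)) <= \rank (E 2 :&: kermx (L y)))%N.
  by rewrite mxrankS // capmxS.
have leE2' : (\rank P3 <= \rank (E 2 *m L y :&: kermx (L z)))%N.
  by rewrite mxrankS // capmxS // submxMr.
have ry2 := dual_rank y z.
have le_s : ((\rank (P3 *m L t)).*2 <= k)%N.
  (* [S u] is the Gram matrix of the form sending [p], [q] of degree 1 to the pairing value of
     [x y u p q]. *)
  pose S u := E 1 *m L x *m L y *m L u *m (B *m (E 1)^T).
  have rS u : \rank (S u) = \rank (E 1 *m L x *m L y *m L u).
    exact/(@rank_pairing 4%N)/Ex.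
  have symS u : (S u)^T = S u.
    rewrite /S !trmx_mul trmxK symB -!mulmxA; congr (_ *m _).
    do 3![rewrite (mulmxA B) adjB -(mulmxA _ B)].
    rewrite !mulmxA; congr (_ *m _ *m _); rewrite -mulmxA [L y *m L x]commL.
    by rewrite mulmxA [L u *m L x]commL -mulmxA [L u *m L y]commL mulmxA.
  have -> : k = \rank (S z) by rewrite rS rxyz.
  have linS v : S (z + v *: t) = S z + v *: S t.
    by rewrite addrC /S linAM addrC.
  apply: leq_trans (rank_ker_sym_pencil charK0 (symS z) (symS t) _ _); last 2 first.
  - by move=> v; rewrite -linS !rS rxyz.
  - by rewrite !rS rxyz.
  rewrite leq_double -(@rank_pairing 4%N _ (P3 *m L t)) //; last first.
    exact/Ex/(submx_trans (capmxSl _ _)).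
  (* Elements of [P3] are [x y] times kernel vectors of [S z], so pairing [P3 *m L t] with degree 1
     lands in [kermx (S z) *m S t]. *)
  apply: mxrankS; have /submxP[D defP3] : (P3 <= kermx (S z) *m (E 1 *m L x *m L y))%MS.
    have /submxP[D defD] : (P3 <= E 1 *m L x *m L y)%MS by exact: capmxSl.
    rewrite defD submxMr //; apply/sub_kermxP.
    by rewrite mulmxA [D *m _]mulmxA -defD (sub_kermxP (capmxSr _ _)) mul0mx.
  by rewrite defP3 /S -!mulmxA submxMl.
(* By Pascal's rule p1 + p2 + p3 + k equals ['C(m + 2, 4) + 'C(m + 1, 3) + 'C(m, 2) + 2m], and the
   target for p2 + 2 p3 + k is ['C(m + 1, 3) + 2 'C(m, 2) + 2m]. Expanding all binomials leaves
   linear arithmetic. *)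
move: rE1 gy0 gz0 gy gz gt le12 le23 leE2' le_s; rewrite /K1 /P2 /P3.
case: (m) m_gt0 => // m' _; rewrite !(addnS, addn0) /= !(binS, bin1, bin0).
lia.
Qed.

End LowerBound.

(** * Coordinates on a graded Gorenstein quotient *)

Section Coordinates.

Variables (K : fieldType) (n : nat).
Implicit Types (p q : {mpoly K[n]}) (I : {mpoly K[n]} -> Prop).

Lemma hcompE d p : hcomp d p = pihomog mdeg d p.
Proof. by rewrite pihomogE. Qed.

Lemma is_homogP d p : is_homog d p <-> p \is d.-homog.
Proof. by split=> [hp|/dhomogP]; first exact/dhomogP. Qed.

Lemma mpoly_sum_hcomp p k : (msize p <= k)%N -> p = \sum_(d < k) hcomp d p.
Proof.
by move=> le_k; rewrite {1}(pihomog_partitionE le_k); apply: eq_bigr => d _; rewrite hcompE.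
Qed.

Section Ideal.

Variable I : {mpoly K[n]} -> Prop.
Hypothesis idI : is_ideal I.

Lemma ideal0 : I 0. Proof. by case: idI. Qed.

Lemma idealD p q : I p -> I q -> I (p + q). Proof. by case: idI => _ + _; apply. Qed.

Lemma idealMl p q : I q -> I (p * q). Proof. by case: idI => _ _; apply. Qed.

Lemma idealMr p q : I p -> I (p * q). Proof. by rewrite mulrC; apply: idealMl. Qed.

Lemma idealZ c p : I p -> I (c *: p).
Proof. by rewrite -mul_mpolyC; apply: idealMl. Qed.

Lemma idealN p : I p -> I (- p). Proof. by rewrite -scaleN1r; apply: idealZ. Qed.

Lemma idealB p q : I p -> I q -> I (p - q).
Proof. by move=> Ip Iq; apply: idealD Ip (idealN Iq). Qed.

Lemma ideal_sum (T : Type) (r : seq T) (P : pred T) (f : T -> {mpoly K[n]}) :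
  (forall i, P i -> I (f i)) -> I (\sum_(i <- r | P i) f i).
Proof. by move=> If; apply: (big_ind I) => //; [exact: ideal0 | exact: idealD]. Qed.

(** Freeness modulo [I] makes the chosen coordinates unique, and uniqueness makes them linear. *)
Lemma hilb_coord d h : hilb_fun_at I d h ->
  exists (f : {linear {mpoly K[n]} -> 'rV[K]_h}) (b : 'I_h -> {mpoly K[n]}),
    [/\ forall p, f p = 0 <-> I (hcomp d p), forall j, is_homog d (b j) &
        forall j, f (b j) = delta_mx 0 j].
Proof.
move=> [b [b_homog b_free b_span]].
have coord p : exists v : 'rV[K]_h, I (hcomp d p - \sum_j v 0 j *: b j).
  have [|c Ic] := b_span (hcomp d p).
    by apply/is_homogP; rewrite hcompE pihomogP.
  exists (\row_j c j); congr (I (_ - _)): Ic.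
  by apply: eq_bigr => j _; rewrite mxE.
pose f p := proj1_sig (constructive_indefinite_description _ (coord p)).
have fP p : I (hcomp d p - \sum_j f p 0 j *: b j).
  by rewrite /f; case: constructive_indefinite_description.
have uniq_f p (v : 'rV[K]_h) : I (hcomp d p - \sum_j v 0 j *: b j) -> f p = v.
  move=> /(idealB (fP p)); rewrite opprB addrC addrA subrK -sumrB => If.
  apply/rowP => j; apply/esym/eqP; rewrite -subr_eq0; apply/eqP.
  apply: (b_free (fun j => v 0 j - f p 0 j)); congr I: If.
  by apply: eq_bigr => i _; rewrite scalerBl.
have lin_f : linear f.
  move=> a p q; apply: uniq_f.
  have /(idealD (idealZ a (fP p))) := fP q; congr I.
  rewrite !hcompE linearP /= scalerBr addrACA -opprD; congr (_ - _).
  rewrite scaler_sumr -big_split /=; apply: eq_bigr => j _.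
  by rewrite !mxE scalerDl scalerA.
pose F : {linear {mpoly K[n]} -> 'rV[K]_h} :=
  HB.pack f (GRing.isLinear.Build _ _ _ _ f lin_f).
exists F, b; split=> // [p|j]; last first.
  apply: uniq_f; rewrite (bigD1 j) //= big1 ?addr0; last first.
    by move=> i /negbTE ne_ij; rewrite mxE eqxx ne_ij scale0r.
  rewrite mxE !eqxx scale1r hcompE pihomog_dE ?subrr; first exact: ideal0.
  exact/is_homogP.
split=> [fp0|Ip]; last first.
  by apply: uniq_f; rewrite big1 ?subr0 // => j _; rewrite mxE scale0r.
have := fP p; rewrite [f p]fp0 big1 ?subr0 // => j _; by rewrite mxE scale0r.
Qed.

Lemma truncated_quotient_coord (H : nat -> nat) k :
  (forall d, hilb_fun_at I d (H d)) ->
  exists N (f : {linear {mpoly K[n]} -> 'rV[K]_N}) (s : 'I_N -> {mpoly K[n]}),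
    (forall p, f p = 0 <-> forall d, (d < k)%N -> I (hcomp d p)) /\
    forall j, f (s j) = delta_mx 0 j.
Proof.
move=> hilbI; elim: k => [|k [N [f [s [kerf fs]]]]].
  pose f (p : {mpoly K[n]}) : 'rV[K]_0 := 0.
  have lin_f : linear f by move=> a p q; rewrite /f scaler0 addr0.
  pose F : {linear {mpoly K[n]} -> 'rV[K]_0} :=
    HB.pack f (GRing.isLinear.Build _ _ _ _ f lin_f).
  by exists 0%N, F, (fun=> 0); split=> [p|[]//]; split.
have [g [b [kerg b_homog gb]]] := hilb_coord (hilbI k).
pose f' p := row_mx (f p) (g p).
have lin_f' : linear f'.
  by move=> a p q; rewrite /f' !linearP scale_row_mx add_row_mx.
pose F : {linear {mpoly K[n]} -> 'rV[K]_(N + H k)} :=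
  HB.pack f' (GRing.isLinear.Build _ _ _ _ f' lin_f').
have fb j : f (b j) = 0.
  apply/kerf => d lt_d; rewrite hcompE (@pihomog_ne0 _ _ _ k) ?gtn_eqF //.
    exact: ideal0.
  exact/is_homogP.
(* An old lift may have a component in degree [k]; subtracting its expansion in [b] clears it and
   leaves the coordinates [f] unchanged. *)
pose s' (i : 'I_(N + H k)) := match split i with
  | inl j => s j - \sum_l g (s j) 0 l *: b l
  | inr j => b j
  end.
exists (N + H k)%N, F, s'; split=> [p|i].
  split=> [/eqP|kp].
    rewrite [F p]/(f' p) row_mx_eq0 => /andP[/eqP /kerf kp /eqP /kerg gp] d.
    by rewrite ltnS leq_eqVlt => /predU1P[->|/kp].
  apply/eqP; rewrite [F p]/(f' p) row_mx_eq0; apply/andP; split; apply/eqP.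
    by apply/kerf => d /ltnW; apply: kp.
  exact/kerg/kp.
rewrite [F _]/(f' _) /f' /s' -[i in RHS]splitK; case: (split i) => j /=.
  rewrite delta_mx_lshift !linearB (linear_sum f) (linear_sum g) /= fs; congr row_mx.
    by rewrite big1 ?subr0 // => l _; rewrite linearZ /= fb scaler0.
  apply/eqP; rewrite subr_eq0 {1}(row_sum_delta (g (s j))); apply/eqP.
  by apply: eq_bigr => l _; rewrite linearZ /= gb.
by rewrite delta_mx_rshift fb gb.
Qed.

(** The coordinates of a basis form an [h] by [N] matrix; passing to [<<A>>] makes it square, so
    that all degrees share one matrix type. *)
Lemma graded_basis N (f : {linear {mpoly K[n]} -> 'rV[K]_N}) d h :
  (forall p, f p = 0 -> I p) -> (forall p, I p -> f p = 0) ->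
  hilb_fun_at I d h ->
  exists E : 'M[K]_N, \rank E = h /\
    forall v : 'rV[K]_N, (v <= E)%MS <-> exists p, is_homog d p /\ f p = v.
Proof.
move=> ker1 ker2 [b [b_homog b_free b_span]].
pose A := \matrix_j f (b j).
have mulA (v : 'rV_h) : v *m A = f (\sum_j v 0 j *: b j).
  rewrite mulmx_sum_row linear_sum; apply: eq_bigr => j _.
  by rewrite rowK linearZ.
exists (<<A>>)%MS; rewrite mxrank_gen; split=> [|v].
  apply/eqP; change (row_free A); rewrite -kermx_eq0; apply/rowV0P => v /sub_kermxP.
  rewrite mulA => /ker1 /b_free v0; apply/rowP => j.
  by rewrite v0 mxE.
rewrite genmxE; split=> [/submxP[u ->]|[p [p_homog <-]]].
  exists (\sum_j u 0 j *: b j); split=> //; apply/is_homogP.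
  by apply: rpred_sum => j _; apply/rpredZ/is_homogP.
have [c /ker2/eqP] := b_span p p_homog.
rewrite linearB subr_eq0 => /eqP ->; apply/submxP; exists (\row_j c j).
by rewrite mulA; congr (f _); apply: eq_bigr => j _; rewrite mxE.
Qed.

End Ideal.
End Coordinates.

(** * From a Gorenstein quotient to matrices with a pairing *)

Section Gorenstein.

Variables (K : fieldType) (r h : nat) (I : {mpoly K[r]} -> Prop).
Hypothesis charK0 : [pchar K] =i pred0.
Hypothesis SGAG : SGAG_with_hilb I [:: 1%N; r; h; h; r; 1%N].

Let idI : is_ideal I. Proof. by case: SGAG => -[]. Qed.
Let hilbI d : hilb_fun_at I d (nth 0%N [:: 1%N; r; h; h; r; 1%N] d).
Proof. by case: SGAG. Qed.

Let ideal_ge6 d p : (5 < d)%N -> is_homog d p -> I p.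
Proof.
move=> lt_d p_homog; have := hilbI d; rewrite nth_default // => -[b [_ _ b_span]].
by have [c] := b_span p p_homog; rewrite big_ord0 subr0.
Qed.

Let coords : exists N (f : {linear {mpoly K[r]} -> 'rV[K]_N}) (s : 'I_N -> {mpoly K[r]}),
  (forall p, f p = 0 <-> I p) /\ forall j, f (s j) = delta_mx 0 j.
Proof.
have [N [f [s [kerf fs]]]] := truncated_quotient_coord idI 6 hilbI.
exists N, f, s; split=> // p; rewrite kerf; split=> [Ip|Ip d _]; last first.
  by case: SGAG => -[_ homI] _ _ _ _; apply: homI.
rewrite (mpoly_sum_hcomp (leqnn (msize p))); apply: (ideal_sum idI) => d _.
case: (ltnP d 6) => [/Ip //|/ideal_ge6]; apply.
by apply/is_homogP; rewrite hcompE pihomogP.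
Qed.

Let top_form : exists e, [/\ is_homog 5 e, ~ I e &
  forall p, is_homog 5 p -> exists c, I (p - c *: e)].
Proof.
have [b [b_homog b_free b_span]] := hilbI 5; exists (b ord0); split=> // [Ie|p].
  have := b_free (fun=> 1); rewrite big_ord1 scale1r => /(_ Ie ord0)/eqP.
  by rewrite oner_eq0.
by move=> /b_span[c]; rewrite big_ord1; exists (c ord0).
Qed.

(** The socle is a line containing the degree 5 form [e]. A nonzero multiple of [p] is thus
    congruent to a multiple of [e], and the degree [d] component of this relation has no [e] in
    it. *)
Let socle_top d p : (d < 5)%N -> is_homog d p -> in_socle I p -> I p.
Proof.
move=> lt_d p_homog p_socle; have [e [e_homog eI _]] := top_form.
have [_ _ _ [t [_ tI t_span]] _] := SGAG.
have e_socle : in_socle I e.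
  move=> i; apply: (@ideal_ge6 6) => //; apply/is_homogP.
  by apply: (@dhomogM _ _ _ 5 _ 1); [exact/is_homogP | rewrite dhomogX /= mdeg1].
have [c1 I1] := t_span e e_socle; have [c2 I2] := t_span p p_socle.
have c1_neq0 : c1 != 0.
  by apply: contra_not_neq eI => c10; rewrite c10 scale0r subr0 in I1.
have : I (c1 *: p - c2 *: e).
  have := idealB idI (idealZ idI c1 I2) (idealZ idI c2 I1); congr I.
  rewrite !scalerBr !scalerA [c2 * c1]mulrC opprB addrA.
  by rewrite subrK.
case: SGAG => -[_ homI] _ _ _ _ /(homI _ d); rewrite hcompE linearB !linearZ /=.
rewrite pihomog_dE; last exact/is_homogP.
rewrite (@pihomog_ne0 _ _ _ 5) ?gtn_eqF //; last exact/is_homogP.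
rewrite oppr0 scaler0 addr0 => /(idealZ idI c1^-1).
by rewrite scalerA mulVf // scale1r.
Qed.

Lemma gorenstein_h2_bound m : (0 < m)%N -> r = (m + 'C(m + 3, 4))%N ->
  ('C(m + 2, 3) + 'C(m + 1, 2) <= h)%N.
Proof.
move=> m_gt0 def_r; have [N [f [s [kerf fs]]]] := coords.
have [e [e_homog eI e_span]] := top_form.
(* The column [w] defines the functional [f p *m w] on the quotient, with value 1 at [e]; the
   pairing [B] evaluates it on products. *)
have /row_freeP[w ew] : row_free (f e).
  rewrite /row_free eqn_leq rank_leq_row /= lt0n mxrank_eq0.
  by apply: contra_not_neq eI => /kerf.
pose mul p := \matrix_j f (s j * p).
have fmul p q : f p *m mul q = f (p * q).
  have : f (p - \sum_j f p 0 j *: s j) = 0.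
    rewrite linearB linear_sum /= [f p in X in X - _]row_sum_delta -sumrB big1 // => j _.
    by rewrite linearZ /= fs subrr.
  move/kerf/(idealMr idI q)/kerf/eqP.
  rewrite mulrBl linearB subr_eq0 mulr_suml linear_sum /= => /eqP ->.
  rewrite mulmx_sum_row; apply: eq_bigr => j _.
  by rewrite -scalerAl linearZ rowK.
have ext m' (A A' : 'M_(N, m')) : (forall p, f p *m A = f p *m A') -> A = A'.
  by move=> eqA; apply/row_matrixP => j; rewrite !rowE -fs.
pose B := \matrix_(i, j) (f (s i * s j) *m w) 0 0.
have fB p q : f p *m B *m (f q)^T = f (p * q) *m w.
  have fBs j : (f p *m B) 0 j = (f (p * s j) *m w) 0 0.
    rewrite -fmul -mulmxA !mxE; apply: eq_bigr => i _.
    by rewrite !mxE; congr (_ * _); apply: eq_bigr => l _; rewrite !mxE.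
  rewrite [p * q]mulrC -fmul -(mulmxA (f q)); apply/matrixP => i j.
  rewrite !ord1 [LHS]mxE [RHS]mxE; apply: eq_bigr => l _.
  rewrite fBs mulrC [p * s l]mulrC mxE; congr (_ * _).
  by rewrite !mxE; apply: eq_bigr => l' _; rewrite !mxE.
have ext2 (A A' : 'M_N) :
    (forall p q, f p *m A *m (f q)^T = f p *m A' *m (f q)^T) -> A = A'.
  move=> eqA; apply: (ext) => p; apply: trmx_inj; apply: ext => q.
  by apply: trmx_inj; rewrite !trmx_mul !trmxK.
pose L (u : 'rV[K]_r) := mul (\sum_i u 0 i *: 'X_i).
have lin_form (u : 'rV[K]_r) : (\sum_i u 0 i *: 'X_i : {mpoly K[r]}) \is 1.-homog.
  by apply: rpred_sum => i _; apply: rpredZ; rewrite dhomogX /= mdeg1.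
have [E EP] : exists E : nat -> 'M[K]_N, forall d,
    \rank (E d) = nth 0%N [:: 1%N; r; h; h; r; 1%N] d /\
    forall v : 'rV[K]_N, (v <= E d)%MS <-> exists p, is_homog d p /\ f p = v.
  have ex_E d := graded_basis (fun p => proj1 (kerf p)) (fun p => proj2 (kerf p)) (hilbI d).
  exists (fun d => proj1_sig (constructive_indefinite_description _ (ex_E d))) => d.
  by case: constructive_indefinite_description.
have fE d p : is_homog d p -> (f p <= E d)%MS.
  by move=> p_homog; apply/(EP d).2; exists p.
have commL u v : L u *m L v = L v *m L u.
  by apply: ext => p; rewrite !mulmxA !fmul mulrAC.
have linL : linear L.
  move=> t u v; apply: ext => p; rewrite mulmxDr -scalemxAr !fmul -linearP.
  rewrite scalerAr -mulrDr; congr (f (_ * _)).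
  rewrite scaler_sumr -big_split; apply: eq_bigr => i _.
  by rewrite !mxE scalerDl scalerA.
have EL d u : (E d *m L u <= E d.+1)%MS.
  apply/row_subP => i; rewrite row_mul.
  have /(EP d).2[p [p_homog <-]] := row_sub i (E d).
  rewrite fmul; apply/fE/is_homogP; rewrite -[d.+1]addn1.
  by apply: dhomogM => //; apply/is_homogP.
have E_nondeg d (v : 'rV_N) : (d < 5)%N ->
    (v <= E d)%MS -> (forall u, v *m L u = 0) -> v = 0.
  move=> lt_d /(EP d).2[p [p_homog <-]] pL; apply/kerf.
  apply: (socle_top lt_d p_homog) => i; apply/kerf.
  rewrite -[RHS](pL (delta_mx 0 i)) fmul; congr (f (_ * _)).
  rewrite (bigD1 i) //= big1 ?addr0 => [|j /negbTE ne_ji].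
    by rewrite mxE !eqxx scale1r.
  by rewrite mxE ne_ji andbF scale0r.
have symB : B^T = B by apply/matrixP => i j; rewrite !mxE [s j * _]mulrC.
have adjB u : B *m (L u)^T = L u *m B.
  apply: ext2 => p q; rewrite !mulmxA fmul fB -mulmxA -trmx_mul fmul fB.
  by rewrite [q * _]mulrC mulrA.
(* If [p] pairs to 0 with degree [e'.+1], each [p * 'X_i] pairs to 0 with degree [e'] and vanishes
   by induction, so [p] is a socle element below degree 5. In degree 5, pairing with 1 is enough. *)
have nondeg e' p : (e' <= 5)%N -> is_homog (5 - e') p ->
    (forall q, is_homog e' q -> f (p * q) *m w = 0) -> f p = 0.
  elim: e' p => [|e' IHe] p le_e p_homog p0.
    have [c /kerf/eqP] := e_span p p_homog.
    rewrite linearB linearZ /= subr_eq0 => /eqP fp.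
    have := p0 1; rewrite mulr1 fp -scalemxAl ew.
    have homog1 : is_homog 0 (1 : {mpoly K[r]}) by apply/is_homogP/dhomog1.
    move/(_ homog1)/matrixP/(_ 0 0)/eqP.
    by rewrite !mxE mulr1 => /eqP ->; rewrite scale0r.
  apply/kerf; apply: (@socle_top (5 - e'.+1)) => //; first by lia.
  move=> i; apply/kerf; apply: IHe => [||q q_homog]; first exact: ltnW.
    have -> : (5 - e' = (5 - e'.+1) + 1)%N by lia.
    apply/is_homogP/dhomogM; last by rewrite dhomogX /= mdeg1.
    exact/is_homogP.
  rewrite -mulrA; apply: p0; apply/is_homogP; rewrite -[e'.+1]add1n.
  by apply: dhomogM; [rewrite dhomogX /= mdeg1 | apply/is_homogP].
have B_nondeg d (v : 'rV[K]_N) : (d <= 5)%N ->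
    (v <= E d)%MS -> v *m (B *m (E (5 - d)%N)^T) = 0 -> v = 0.
  move=> le_d /(EP d).2[p [p_homog <-]] pB; apply: (nondeg (5 - d)%N).
  - exact: leq_subr.
  - by rewrite subKn.
  move=> q /fE/submxP[D fq]; rewrite -fB fq trmx_mul mulmxA.
  by rewrite -[f p *m B *m _]mulmxA pB mul0mx.
have := pairing_rank_bound charK0 linL commL EL E_nondeg symB adjB B_nondeg m_gt0.
by rewrite (EP 1%N).1 (EP 2%N).1; apply.
Qed.

End Gorenstein.

(** * The trivial extension of a truncated polynomial ring *)

Section InverseSystem.

Variables (K : fieldType) (n e : nat) (Phi : {scalar {mpoly K[n]}}).
Hypothesis Phi_homog : forall u : 'X_{1..n}, mdeg u != e -> Phi 'X_[u] = 0.
Variable top : 'X_{1..n}.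
Hypothesis Phi_top : Phi 'X_[top] = 1.

(** Macaulay's inverse system: under contraction, this is the annihilator of the form whose
    coefficients are the values of [Phi] on monomials. *)
Definition annihilator (p : {mpoly K[n]}) := forall u : 'X_{1..n}, Phi (p * 'X_[u]) = 0.

Lemma annihilatorP p : annihilator p <-> forall q, Phi (p * q) = 0.
Proof.
split=> [p0 q|p0 u]; last exact: p0.
rewrite [q]mpolyE mulr_sumr linear_sum big1 //= => u _.
by rewrite -scalerAr linearZ /= p0 mulr0.
Qed.

Lemma annihilator_ideal : is_ideal annihilator.
Proof.
split=> [u|p q p0 q0 u|p q /annihilatorP q0 u]; first by rewrite mul0r linear0.
  by rewrite mulrDl linearD p0 q0 addr0.
by rewrite [p * q]mulrC -mulrA q0.
Qed.

Lemma Phi_homog_eq0 d p : p \is d.-homog -> d != e -> Phi p = 0.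
Proof.
move=> /dhomogP p_homog ne_de; rewrite [p]mpolyE linear_sum big_seq big1 //= => u up.
by rewrite linearZ /= Phi_homog ?mulr0 // [mdeg u]p_homog.
Qed.

Lemma Phi_hcomp d p u : Phi (hcomp d p * 'X_[u]) =
  if (d + mdeg u == e)%N then Phi (p * 'X_[u]) else 0.
Proof.
have PhiX c v : Phi (c *: 'X_[v] * 'X_[u]) = c * Phi 'X_[v + u].
  by rewrite -scalerAl linearZ mpolyXD.
rewrite /hcomp mulr_suml linear_sum; case: eqP => [def_e|ne_e].
  rewrite [p in RHS]mpolyE mulr_suml linear_sum [LHS]big_mkcond /=.
  apply: eq_bigr => v _; case: eqP => // ne_d; rewrite PhiX Phi_homog ?mulr0 //.
  by apply/eqP; rewrite mdegD -def_e => /addIn.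
rewrite big1 // => v /eqP deg_v; rewrite PhiX Phi_homog ?mulr0 //.
by apply/eqP; rewrite mdegD deg_v.
Qed.

Lemma annihilator_homog : is_homog_ideal annihilator.
Proof.
split=> [|p d p0 u]; first exact: annihilator_ideal.
by rewrite Phi_hcomp p0 if_same.
Qed.

Lemma annihilator_gt d p : (e < d)%N -> is_homog d p -> annihilator p.
Proof.
move=> lt_ed /is_homogP p_homog u; apply: (@Phi_homog_eq0 (d + mdeg u)%N).
  by apply: dhomogM => //; rewrite dhomogX.
by rewrite gtn_eqF // ltn_addr.
Qed.

Lemma annihilator_artinian : artinian_quot annihilator.
Proof. by exists e.+1 => d p; apply: annihilator_gt. Qed.

(** A socle element [t] is congruent to [Phi t] times the monomial [top]: both have the same value
    when paired with 1, and every other monomial contains a variable, which kills both. *)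
Lemma annihilator_gorenstein : gorenstein_quot annihilator.
Proof.
have deg_top : mdeg top = e.
  by apply/eqP/contraT => /Phi_homog /eqP; rewrite Phi_top oner_eq0.
have top_socle : in_socle annihilator 'X_[top].
  move=> i; apply: (@annihilator_gt e.+1) => //; apply/is_homogP.
  by rewrite -mpolyXD dhomogX /= mdegD mdeg1 deg_top addn1.
exists 'X_[top]; split=> // [|t t_socle].
  by move=> /(_ 0%MM)/eqP; rewrite mpolyX0 mulr1 Phi_top oner_eq0.
exists (Phi t) => u; have [->|u_neq0] := eqVneq u 0%MM.
  by rewrite mpolyX0 mulr1 linearB linearZ /= Phi_top mulr1 subrr.
have [i ui] : exists i, u i != 0%N.
  apply/existsP; apply: contraR u_neq0 => /existsPn u0.
  by apply/eqP/mnmP => i; rewrite mnm0E; apply/eqP/negPn/u0.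
rewrite -(@submK _ U_(i) u) ?lep1mP // addmC mpolyXD mulrA mulrBl -scalerAl.
rewrite mulrBl -scalerAl linearB linearZ /= t_socle top_socle.
by rewrite mulr0 subrr.
Qed.

(** The dual family [b'] gives independence and reads off coefficients, so spanning need only be
    checked on monomials. *)
Lemma annihilator_hilb d h (b b' : 'I_h -> {mpoly K[n]}) :
  (forall j, is_homog d (b j)) -> (forall i j, Phi (b i * b' j) = (i == j)%:R) ->
  (forall u : 'X_{1..n}, mdeg u = d ->
     annihilator 'X_[u] \/ exists i, annihilator ('X_[u] - b i)) ->
  hilb_fun_at annihilator d h.
Proof.
move=> b_homog b_dual b_span; have idI := annihilator_ideal; exists b; split=> //.
  move=> c /annihilatorP c0 j; have := c0 (b' j).
  rewrite mulr_suml linear_sum (bigD1 j) //= big1 => [|i /negbTE ne_ij].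
    by rewrite -scalerAl linearZ /= b_dual eqxx mulr1 addr0.
  by rewrite -scalerAl linearZ /= b_dual ne_ij mulr0.
move=> p p_homog; exists (fun j => Phi (p * b' j)).
rewrite {1}[p]mpolyE.
have -> : \sum_j Phi (p * b' j) *: b j =
    \sum_(u <- msupp p) p@_u *: \sum_j Phi ('X_[u] * b' j) *: b j.
  under [RHS]eq_bigr do rewrite scaler_sumr; rewrite exchange_big.
  apply: eq_bigr => j _; rewrite {1}[p]mpolyE mulr_suml linear_sum scaler_suml.
  by apply: eq_bigr => u _; rewrite -scalerAl linearZ scalerA.
rewrite -sumrB big_seq; apply: (ideal_sum idI) => u /p_homog/b_span u_span.
rewrite -scalerBr; apply: (idealZ idI).
case: u_span => [u0|[i ui]].
  by rewrite big1 ?subr0 // => j _; rewrite (annihilatorP _).1 // scale0r.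
have Phi_u j : Phi ('X_[u] * b' j) = (i == j)%:R.
  by apply/eqP; rewrite -b_dual -subr_eq0 -linearB -mulrBl (annihilatorP _).1.
rewrite (bigD1 i) //= big1 => [|j /negbTE]; first by rewrite Phi_u eqxx scale1r addr0.
by rewrite eq_sym Phi_u => ->; rewrite scale0r.
Qed.

End InverseSystem.

(** * The quintic whose terms are the products of [y_M] and [M] *)

Section Monomials.

Variable m : nat.
Let t := 'C(m.+1 + 3, 4).
Let r := (m.+1 + t)%N.

Definition monomials d : seq 'X_{1..m.+1} :=
  [seq s2m t | t : d.-tuple 'I_m.+1 <- enum (basis m.+1 d)].

Lemma mem_monomials d (u : 'X_{1..m.+1}) : (u \in monomials d) = (mdeg u == d).
Proof. by rewrite basis_cover. Qed.

Lemma size_monomials d : size (monomials d) = 'C(d + m, d).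
Proof. exact: size_basis. Qed.

Definition quartic (j : 'I_t) : 'X_{1..m.+1} := nth 0%MM (monomials 4) j.

Lemma mdeg_quartic j : mdeg (quartic j) = 4%N.
Proof.
apply/eqP; rewrite -mem_monomials mem_nth // size_monomials.
by rewrite (_ : (4 + m = m.+1 + 3)%N) ?ltn_ord //; lia.
Qed.

Lemma quartic_inj : injective quartic.
Proof.
have sz j : (j < t)%N -> (j < size (monomials 4))%N.
  by rewrite size_monomials (_ : (4 + m = m.+1 + 3)%N) //; lia.
move=> i j /eqP; rewrite /quartic nth_uniq ?sz ?uniq_basis // => /eqP; exact: val_inj.
Qed.

Lemma quartic_surj u : mdeg u = 4%N -> exists j, quartic j = u.
Proof.
move/eqP; rewrite -mem_monomials => /(nthP 0%MM)[j lt_j <-].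
have lt_jt : (j < t)%N.
  by move: lt_j; rewrite size_monomials (_ : (4 + m = m.+1 + 3)%N) //; lia.
by exists (Ordinal lt_jt).
Qed.

(** The first [m.+1] variables are the x's; the last [t] are the y's, one for each quartic monomial
    in x. *)
Definition xpart (u : 'X_{1..r}) : 'X_{1..m.+1} := [multinom u (lshift t i) | i < m.+1].
Definition ypart (u : 'X_{1..r}) : 'X_{1..t} := [multinom u (rshift m.+1 j) | j < t].
Definition xmon (a : 'X_{1..m.+1}) : 'X_{1..r} :=
  [multinom if split i is inl j then a j else 0%N | i < r].

Lemma xpartD u v : xpart (u + v) = (xpart u + xpart v)%MM.
Proof. by apply/mnmP => i; rewrite !mnmE. Qed.

Lemma ypartD u v : ypart (u + v) = (ypart u + ypart v)%MM.
Proof. by apply/mnmP => i; rewrite !mnmE. Qed.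

Lemma xpart_xmon a : xpart (xmon a) = a.
Proof. by apply/mnmP => i; rewrite !mnmE (unsplitK (inl i)). Qed.

Lemma ypart_xmon a : ypart (xmon a) = 0%MM.
Proof. by apply/mnmP => i; rewrite !mnmE (unsplitK (inr i)). Qed.

Lemma xpart_y j : xpart U_(rshift m.+1 j) = 0%MM.
Proof. by apply/mnmP => i; rewrite !mnmE eq_rlshift. Qed.

Lemma ypart_y j : ypart U_(rshift m.+1 j) = U_(j)%MM.
Proof. by apply/mnmP => i; rewrite !mnmE eq_rshift. Qed.

Lemma xypart_inj u v : xpart u = xpart v -> ypart u = ypart v -> u = v.
Proof.
move=> /mnmP eq_x /mnmP eq_y; apply/mnmP => i; rewrite -[i]splitK.
case: (split i) => j /=; first by have := eq_x j; rewrite !mnmE.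
by have := eq_y j; rewrite !mnmE.
Qed.

Lemma mdeg_xypart u : mdeg u = (mdeg (xpart u) + mdeg (ypart u))%N.
Proof.
rewrite !mdegE big_split_ord /=.
by congr (_ + _)%N; apply: eq_bigr => i _; rewrite mnmE.
Qed.

Variable K : fieldType.

Definition top_mon (j : 'I_t) : 'X_{1..r} := (U_(rshift m.+1 j) + xmon (quartic j))%MM.

(** Contraction of the degree 5 part of [p] against the quintic. *)
Definition coef_sum (p : {mpoly K[r]}) : K := \sum_j p@_(top_mon j).

Lemma coef_sum_linear : scalar coef_sum.
Proof.
move=> a p q; rewrite /coef_sum mulr_sumr -big_split /=.
by apply: eq_bigr => j _; rewrite mcoeffD mcoeffZ.
Qed.

HB.instance Definition _ :=
  GRing.isLinear.Build K {mpoly K[r]} K _ coef_sum coef_sum_linear.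

Local Notation Phi := (coef_sum : {scalar {mpoly K[r]}}).

Lemma ypart_top j : ypart (top_mon j) = U_(j)%MM.
Proof. by rewrite ypartD ypart_y ypart_xmon addm0. Qed.

Lemma xpart_top j : xpart (top_mon j) = quartic j.
Proof. by rewrite xpartD xpart_y xpart_xmon add0m. Qed.

Lemma Phi_linear_y u j : ypart u = U_(j)%MM -> Phi 'X_[u] = (xpart u == quartic j)%:R.
Proof.
move=> yu; rewrite /= /coef_sum (bigD1 j) //= big1 ?addr0 => [|i ne_ij].
  rewrite mcoeffX; congr (_%:R); congr nat_of_bool.
  apply/eqP/eqP => [->|xu]; first exact: xpart_top.
  by apply: xypart_inj; rewrite ?xpart_top ?ypart_top.
rewrite mcoeffX; case: eqP => // def_u; case/eqP: ne_ij.
by apply/eqP; rewrite -eq_mnm1 -ypart_top -def_u yu.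
Qed.

Lemma Phi_nonlinear_y u : mdeg (ypart u) != 1%N -> Phi 'X_[u] = 0.
Proof.
move=> yu; rewrite /= /coef_sum big1 // => j _; rewrite mcoeffX; case: eqP => // def_u.
by rewrite def_u ypart_top mdeg1 in yu.
Qed.

Lemma Phi_degree u : mdeg u != 5%N -> Phi 'X_[u] = 0.
Proof.
move=> du; rewrite /= /coef_sum big1 // => j _; rewrite mcoeffX; case: eqP => // def_u.
by rewrite def_u mdeg_xypart xpart_top ypart_top mdeg_quartic mdeg1 in du.
Qed.

Lemma Phi_top_mon j : Phi 'X_[top_mon j] = 1.
Proof. by rewrite (Phi_linear_y (ypart_top j)) xpart_top eqxx. Qed.

(* In the quotient, such a [v] is the basis element dual to the monomial [N]. *)
Definition dual_mon (N : 'X_{1..m.+1}) (v : 'X_{1..r}) :=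
  forall u, Phi 'X_[v + u] = (u == xmon N)%:R.

Lemma dual_monP u j N : ypart u = U_(j)%MM -> (xpart u + N)%MM = quartic j ->
  dual_mon N u.
Proof.
move=> yu xu v; have [yv|yv] := eqVneq (ypart v) 0%MM.
  rewrite (@Phi_linear_y _ j) ?ypartD ?yv ?addm0 // xpartD -xu eqm_add2l.
  congr (nat_of_bool _)%:R; apply/eqP/eqP => [xv|->]; last by rewrite xpart_xmon.
  by apply: xypart_inj; rewrite ?xpart_xmon ?ypart_xmon.
rewrite Phi_nonlinear_y; last first.
  by rewrite ypartD yu mdegD mdeg1 add1n eqSS mdeg_eq0.
by case: eqP => // def_v; rewrite def_v ypart_xmon eqxx in yv.
Qed.

(** A power of the first x variable completes [N] to some [quartic j]; the product of [y_j] and that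
    power is dual to [N]. *)
Lemma exists_dual_mon N : (mdeg N <= 4)%N -> exists v, dual_mon N v.
Proof.
move=> le4; have [|j jN] := quartic_surj (u := (U_(ord0) *+ (4 - mdeg N) + N)%MM).
  by rewrite mdegD mdegMn mdeg1 mul1n subnK.
exists (U_(rshift m.+1 j) + xmon (U_(ord0) *+ (4 - mdeg N)))%MM.
apply: (@dual_monP _ j); first by rewrite ypartD ypart_y ypart_xmon addm0.
by rewrite xpartD xpart_y xpart_xmon add0m.
Qed.

Lemma Phi_xmon a a' : Phi 'X_[xmon a + xmon a'] = 0.
Proof. by rewrite Phi_nonlinear_y // ypartD !ypart_xmon addm0 mdeg0. Qed.

Lemma xmon_inj : injective xmon.
Proof. by move=> a a' /(congr1 xpart); rewrite !xpart_xmon. Qed.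

Lemma mdeg_xmon a : mdeg (xmon a) = mdeg a.
Proof. by rewrite mdeg_xypart xpart_xmon ypart_xmon mdeg0 addn0. Qed.

Lemma dual_mon_xmon N a : ~ dual_mon N (xmon a).
Proof.
by move=> /(_ (xmon N))/eqP; rewrite Phi_xmon eqxx eq_sym oner_eq0.
Qed.

Lemma mdeg_dual_mon N v : dual_mon N v -> (mdeg v + mdeg N = 5)%N.
Proof.
move=> /(_ (xmon N))/eqP; rewrite eqxx => Phi1; apply/eqP/contraT.
by rewrite -mdeg_xmon -mdegD => /Phi_degree/eqP; rewrite (eqP Phi1) oner_eq0.
Qed.

(** Split by degree in y. Degree at least 2 gives zero; [y_j] times an x-monomial is dual to the
    quotient of [quartic j] by it, or zero if it does not divide; pure x-monomials survive up to
    degree 4. *)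
Lemma monomial_cases u : (mdeg u <= 5)%N ->
  [\/ annihilator Phi 'X_[u],
      exists2 a, u = xmon a & (mdeg a <= 4)%N | exists N, dual_mon N u].
Proof.
move=> le5; have [y0|y_neq0] := eqVneq (ypart u) 0%MM.
  have def_u : u = xmon (xpart u).
    by apply: xypart_inj; rewrite ?xpart_xmon ?ypart_xmon.
  case: (leqP (mdeg (xpart u)) 4) => [le4|gt4]; first by constructor 2; exists (xpart u).
  constructor 1 => v; rewrite -mpolyXD; have [->|v_neq0] := eqVneq v 0%MM.
    by rewrite addm0 Phi_nonlinear_y // y0 mdeg0.
  apply: Phi_degree; rewrite mdegD def_u mdeg_xmon neq_ltn; apply/orP; right.
  by rewrite -mdeg_eq0 -lt0n in v_neq0; lia.
have [|y_neq1] := boolP (mdeg (ypart u) == 1%N).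
  rewrite mdeg_eq1 => /existsP[j /eqP yu].
  have [le_xu|nle_xu] := boolP (xpart u <= quartic j)%MM.
    constructor 3; exists (quartic j - xpart u)%MM.
    by apply: (dual_monP yu); rewrite addmC submK.
  constructor 1 => v; rewrite -mpolyXD.
  have [yv|yv] := eqVneq (ypart v) 0%MM.
    rewrite (@Phi_linear_y _ j) ?ypartD ?yv ?addm0 // xpartD.
    by case: eqP => // xj; rewrite -xj lem_addr in nle_xu.
  by rewrite Phi_nonlinear_y // ypartD yu mdegD mdeg1 add1n eqSS mdeg_eq0.
constructor 1 => v; rewrite -mpolyXD Phi_nonlinear_y // ypartD mdegD.
by rewrite -mdeg_eq0 in y_neq0; lia.
Qed.

(** Monomial basis of the polynomial ring in x modulo the fifth power of its maximal ideal. *)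
Definition xmonomials d := if (d <= 4)%N then monomials d else [::].

Lemma mem_xmonomials d a : (a \in xmonomials d) = (mdeg a == d) && (d <= 4)%N.
Proof. by rewrite /xmonomials; case: ifP; rewrite ?andbT ?andbF // mem_monomials. Qed.

(** The x-monomials of degree [d] and the duals of those of degree [5 - d] form a basis. Exchanging
    the two kinds gives the dual family. *)
Lemma annihilator_coef_sum_hilb d : (d <= 5)%N ->
  hilb_fun_at (annihilator Phi) d (size (xmonomials d) + size (xmonomials (5 - d))).
Proof.
move=> le5; set s := xmonomials d; set s' := xmonomials (5 - d).
pose a (i : 'I_(size s)) := nth 0%MM s i; pose a' (i : 'I_(size s')) := nth 0%MM s' i.
have sP i : (mdeg (a i) = d) /\ (d <= 4)%N.
  by have := mem_nth 0%MM (ltn_ord i); rewrite mem_xmonomials => /andP[/eqP].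
have s'P i : (mdeg (a' i) = 5 - d)%N /\ (5 - d <= 4)%N.
  by have := mem_nth 0%MM (ltn_ord i); rewrite mem_xmonomials => /andP[/eqP].
have uniq_xmon e : uniq (xmonomials e).
  by rewrite /xmonomials; case: ifP => // _; apply: uniq_basis.
have a_inj i i' : (a i == a i') = (i == i') by rewrite nth_uniq ?uniq_xmon.
have a'_inj i i' : (a' i == a' i') = (i == i') by rewrite nth_uniq ?uniq_xmon.
have le_a i : (mdeg (a i) <= 4)%N by have [-> ->] := sP i.
have le_a' i : (mdeg (a' i) <= 4)%N by have [-> ->] := s'P i.
have [v vP] := fin_all_exists (fun i => exists_dual_mon (le_a i)).
have [v' v'P] := fin_all_exists (fun i => exists_dual_mon (le_a' i)).
pose b i : {mpoly K[r]} := match split i with inl i => 'X_[xmon (a i)] | inr i => 'X_[v' i] end.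
pose b' i : {mpoly K[r]} := match split i with inl i => 'X_[v i] | inr i => 'X_[xmon (a' i)] end.
apply: (annihilator_hilb (b := b) (b' := b')).
- move=> i; apply/is_homogP; rewrite /b; case: (split i) => j; rewrite dhomogX /=.
    by rewrite mdeg_xmon (sP j).1.
  by have := mdeg_dual_mon (v'P j); have [-> _] := s'P j; lia.
- move=> i j; rewrite /b /b' -[i in RHS]splitK -[j in RHS]splitK.
  case: (split i) (split j) => [i'|i'] [j'|j']; rewrite -mpolyXD /=.
  + by rewrite addmC vP (inj_eq xmon_inj) a_inj eq_lshift.
  + by rewrite Phi_xmon eq_lrshift.
  + rewrite v'P eq_rlshift; case: eqP => // def_v.
    by have := vP j'; rewrite def_v => /dual_mon_xmon.
  by rewrite v'P (inj_eq xmon_inj) a'_inj eq_rshift eq_sym.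
move=> u du; have [|u0|[a0 def_u le4]|[N uN]] := monomial_cases (u := u).
- by rewrite du.
- by left.
- right; have a0s : a0 \in s by rewrite mem_xmonomials -du def_u mdeg_xmon eqxx.
  have lt_i : (index a0 s < size s)%N by rewrite index_mem.
  exists (lshift _ (Ordinal lt_i)).
  rewrite /b (unsplitK (inl _)) /a nth_index // -def_u subrr => w.
  by rewrite mul0r linear0.
right; have degN := mdeg_dual_mon uN.
have Ns : N \in s'.
  (* Membership needs [5 - d <= 4]. In degree 0 the only monomial is 1, an x-monomial, which is
     never a dual. *)
  suff : mdeg u != 0%N by rewrite mem_xmonomials; lia.
  apply/negP; rewrite mdeg_eq0 => /eqP u0; apply: (@dual_mon_xmon N 0%MM).
  rewrite (_ : xmon 0%MM = u) // u0; apply: xypart_inj.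
    by rewrite xpart_xmon; apply/mnmP => i; rewrite !mnmE.
  by rewrite ypart_xmon; apply/mnmP => i; rewrite !mnmE.
have lt_i : (index N s' < size s')%N by rewrite index_mem.
have a'i : a' (Ordinal lt_i) = N by rewrite /a' nth_index.
exists (rshift _ (Ordinal lt_i)) => w; rewrite /b (unsplitK (inr _)).
by rewrite mulrBl linearB -!mpolyXD /= uN v'P a'i subrr.
Qed.

Lemma annihilator_coef_sum_linear p : is_homog 1 p -> annihilator Phi p -> p = 0.
Proof.
move=> p_homog p0; apply/mpolyP => u; rewrite mcoeff0.
have [|du] := boolP (mdeg u == 1%N); last first.
  by apply/memN_msupp_eq0; apply: contra du => /p_homog ->.
rewrite mdeg_eq1 => /existsP[i /eqP ->].
(* Each variable has a monomial [v] that isolates its coefficient: a dual of [x_j] for [x_j], and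
   [quartic j] for [y_j]. *)
suff [v vP] : exists v, forall k, Phi 'X_[U_(k) + v] = (k == i)%:R.
  rewrite -(p0 v) [p in LHS]mpolyE [p in RHS]mpolyE mulr_suml !linear_sum /=.
  rewrite !big_seq; apply: eq_bigr => u' /p_homog/eqP.
  rewrite mdeg_eq1 => /existsP[k /eqP ->].
  by rewrite -scalerAl !linearZ -mpolyXD vP /= mcoeffX eq_mnm1.
have xmon1 k : xmon U_(k) = U_(lshift t k)%MM.
  apply/mnmP => l; rewrite !mnmE -[l]splitK; case: (split l) => l' /=.
    by rewrite (unsplitK (inl l')) eq_lshift mnmE.
  by rewrite (unsplitK (inr l')) eq_lrshift.
have dual_y j : dual_mon (quartic j) U_(rshift m.+1 j)%MM.
  by apply: (dual_monP (ypart_y j)); rewrite xpart_y add0m.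
rewrite -[i]splitK; case: (split i) => j /=.
  have [v vP] : exists v, dual_mon U_(j)%MM v by apply: exists_dual_mon; rewrite mdeg1.
  by exists v => k; rewrite addmC vP xmon1 eq_mnm1.
exists (xmon (quartic j)) => k; rewrite -[k]splitK; case: (split k) => k' /=.
  by rewrite -xmon1 Phi_xmon eq_lrshift.
by rewrite dual_y (inj_eq xmon_inj) (inj_eq quartic_inj) eq_rshift eq_sym.
Qed.

Lemma coef_sum_realizable :
  realizable K (m.+1 + 'C(m.+1 + 3, 4)) ('C(m.+1 + 2, 3) + 'C(m.+1 + 1, 2)).
Proof.
have t_gt0 : (0 < t)%N by rewrite bin_gt0; lia.
have [e2 e3 e4] : [/\ 2 + m = m.+1 + 1, 3 + m = m.+1 + 2 & 4 + m = m.+1 + 3]%N.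
  by split; lia.
exists (annihilator Phi); split.
- exact: annihilator_homog Phi_degree.
- exact: annihilator_coef_sum_linear.
- exact: annihilator_artinian Phi_degree.
- exact: (annihilator_gorenstein Phi_degree (Phi_top_mon (Ordinal t_gt0))).
move=> d; have [le5|gt5] := leqP d 5; last first.
  rewrite nth_default //; exists (fun=> 0); split=> [[]//||p p_homog].
    by move=> c _ [].
  exists (fun=> 0); rewrite big_ord0 subr0.
  exact: (annihilator_gt Phi_degree gt5).
have := annihilator_coef_sum_hilb le5.
case: d le5 => [|[|[|[|[|[|]]]]]] // _; rewrite /xmonomials /= ?size_monomials;
  congr hilb_fun_at; rewrite ?(subSS, subn0) ?bin0 ?bin1 //.
all: by rewrite ?(e2, e3, e4, add1n) // addnC.
Qed.


End Monomials.

(* delta(r) = r - mu(r); 4 * delta(r) = (m+5) * C(m,3) written without division *)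
Theorem theorem3p15 (K : fieldType) (charK0 : [pchar K]%R =i pred0) (m : nat) :
  (3 <= m <= 10)%N ->
  let r := (m + 'C(m + 3, 4))%N in
  exists mu : nat, is_mu K r mu /\
    (4 * (r%:Z - mu%:Z) = ((m + 5) * 'C(m, 3))%N%:Z)%R.
Proof.
move=> /andP[m_ge3 _] r; exists ('C(m + 2, 3) + 'C(m + 1, 2))%N; split.
  split=> [|h [I SGAG]].
    by rewrite /r -(prednK (ltnW (ltnW m_ge3))); apply: coef_sum_realizable.
  exact: (gorenstein_h2_bound charK0 SGAG (ltnW (ltnW m_ge3)) (erefl _)).
(* By Pascal's rule r - mu is ['C(m, 4) + 2 'C(m, 3)], and [4 'C(m, 4) = (m - 3) 'C(m, 3)]; adding
   [8 'C(m, 3)] produces the factor [m + 5], the subtraction being exact for [m >= 3]. *)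
have /(congr1 (addn^~ (8 * 'C(m, 3))%N)) := mul_bin_left m 3.
rewrite -mulnDl (_ : m - 3 + 8 = m + 5)%N => [<-|]; last by lia.
rewrite /r !(addnS, addn0, binS, bin1, bin0); lia.
Qed.
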